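(* Let $G$ be a finite abelian group and let $\mathcal{P}=\{P_1,\dots,P_l\}$ be a collection of predicates such that each $P_i$ is a coset of a balanced pairwise independent subgroup of $G^{k_i}$, where $k_{\min}=\min_i k_i\ge 3$. Let $(V,\mathcal{C})$ be an instance of CSP($\mathcal{P}$) that is $(s,1+\delta)$-expanding for some $\delta\le\frac14$. Then there exists a balanced solution to $\frac{s}{16}$ rounds of the Lasserre hierarchy that satisfies every constraint in $\mathcal{C}$.
   Context: An instance $(V,\mathcal{C})$ of CSP($\mathcal{P}$) consists of a set $V$ of variables taking values in $G$ and constraints $C_1,\dots,C_m$, each $C_i$ given by a type $t_i\in\{1,\dots,l\}$ and a tuple $E_i=(e_{i,1},\dots,e_{i,k_{t_i}})$ of distinct variables; an assignment $f:V\to G$ satisfies $C_i$ iff $(f(e_{i,1}),\dots,f(e_{i,k_{t_i}}))\in P_{t_i}$. The instance is $(s,\alpha)$-expanding if for every set of $s'\le s$ constraints $C_{i_1},\dots,C_{i_{s'}}$, $|\bigcup_j E_{i_j}|\ge \sum_j|E_{i_j}|-\alpha s'$. A subset $H\subseteq G^k$ is balanced pairwise independent if the uniform distribution $x$ on $H$ satisfies $\Pr[x_i=g]=1/|G|$ and $\Pr[x_i=g,x_j=g']=1/|G|^2$ for all $i\neq j$, $g,g'\in G$. A $t$-local distribution is a collection $\{X_S(\alpha)\in[0,1]\}$, $S\subseteq V$, $|S|\le t$, $\alpha:S\to G$, with $X_\emptyset=1$ and $\sum_{\beta:T\setminus S\to G}X_T(\alpha\circ\beta)=X_S(\alpha)$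 for all $S\subseteq T$, $|T|\le t$. A solution to $t$ rounds of the Lasserre hierarchy is a family of real vectors $\{V_S(\alpha)\}_{|S|\le t,\alpha:S\to G}$ for which there is a $2t$-local distribution $\{X_S(\alpha)\}$ with $\langle V_S(\alpha),V_T(\beta)\rangle=X_{S\cup T}(\alpha\circ\beta)$ if $\alpha,\beta$ agree on $S\cap T$ and $0$ otherwise. It satisfies $C_i$ if $X_{E_i}(\alpha)=0$ whenever $(\alpha(e_{i,1}),\dots)\notin P_{t_i}$, and is balanced if $X_{\{v\}}(v\mapsto g)=\|V_{\{v\}}(v\mapsto g)\|^2=1/|G|$ for all $v,g$. *)

(* Defs.v *)
From HB Require Import structures.
From mathcomp Require Import all_boot all_order all_algebra.
From mathcomp Require Import reals.

Set Implicit Arguments.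
Unset Strict Implicit.
Unset Printing Implicit Defensive.

Import Order.TTheory GRing.Theory Num.Theory.
Local Open Scope ring_scope.

(* The group G^k is [{ffun 'I_k -> G}] with its pointwise structure. *)
Definition unif_pr (T : finType) (H : {set T}) (A : pred T) : rat :=
  #|[set x in H | A x]|%:R / #|H|%:R.

Definition balanced_pairwise_independent (G : finZmodType) (k : nat)
    (H : {set {ffun 'I_k -> G}}) : Prop :=
  (forall (i : 'I_k) (g : G),
     unif_pr H (fun x => x i == g) = 1 / #|G|%:R) /\
  (forall (i j : 'I_k) (g g' : G), i != j ->
     unif_pr H (fun x => (x i == g) && (x j == g')) = 1 / (#|G|%:R ^+ 2)).

Definition bpi_coset (G : finZmodType) (k : nat)
    (P : {set {ffun 'I_k -> G}}) : Prop :=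
  exists H : {set {ffun 'I_k -> G}},
    [/\ GRing.zmod_closed [in H],
        balanced_pairwise_independent H &
        exists a : {ffun 'I_k -> G}, P = [set a + h | h in H]].

(* Only the arities [k] of the predicates matter for the syntax of an
   instance. *)
Record csp_instance (l : nat) (k : 'I_l -> nat) (V : finType) := CspInstance {
  csp_size : nat;
  ctype : 'I_csp_size -> 'I_l;
  cvar : forall i : 'I_csp_size, 'I_(k (ctype i)) -> V;
  cvar_inj : forall i : 'I_csp_size, injective (cvar (i := i)) }.

Arguments csp_size {l k V} I : rename.
Arguments ctype {l k V} I i : rename.
Arguments cvar {l k V} I i j : rename.

Definition scope (l : nat) (k : 'I_l -> nat) (V : finType)
    (I : csp_instance k V) (i : 'I_(csp_size I)) : {set V} :=
  [set cvar I i j | j in 'I_(k (ctype I i))].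

Lemma cvar_scope (l : nat) (k : 'I_l -> nat) (V : finType)
    (I : csp_instance k V) (i : 'I_(csp_size I)) (j : 'I_(k (ctype I i))) :
  cvar I i j \in scope i.
Proof. exact: imset_f. Qed.

Definition expanding (R : realType) (l : nat) (k : 'I_l -> nat) (V : finType)
    (I : csp_instance k V) (s a : R) : Prop :=
  forall J : {set 'I_(csp_size I)}, #|J|%:R <= s ->
    #|\bigcup_(i in J) scope i|%:R
      >= (\sum_(i in J) #|scope i|)%:R - a * #|J|%:R.

(* The type of assignments S -> G. *)
Notation asg G S := {ffun {x | x \in S} -> G}.

Definition asg1 (V : finType) (G : finZmodType) (v : V) (g : G) :
  asg G [set v] := [ffun => g].

Definition agree (V : finType) (G : finZmodType) (S T : {set V})
    (a : asg G S) (b : asg G T) : bool :=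
  [forall x : {x | x \in S}, forall y : {y | y \in T},
     (val x == val y) ==> (a x == b y)].

(* The assignment to W that is [a] on S and [b] on T; it is only used when
   W is the union of S and T and when a, b agree, so that neither the value 0
   nor the priority given to [a] matters.  W is a separate parameter because
   S :|: (T :\: S) is only propositionally equal to T. *)
Definition glue (V : finType) (G : finZmodType) (W S T : {set V})
    (a : asg G S) (b : asg G T) : asg G W :=
  [ffun x =>
     if (insub (val x) : option {y | y \in S}) is Some y then a y
     else if (insub (val x) : option {y | y \in T}) is Some z then b z
     else 0].

(* Families indexed by the sets of size at most t are total functions of the
   set: their values on larger sets are not constrained by the definitions of
   a local distribution and of a Lasserre solution. The bound t is a real
   number, so that s / 16 rounds makes sense without rounding. *)
Definition local_distribution (R : realType) (V : finType) (G : finZmodType)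
    (t : R) (X : forall S : {set V}, asg G S -> R) : Prop :=
  [/\ forall (S : {set V}) (a : asg G S), #|S|%:R <= t -> 0 <= X S a <= 1,
      forall a : asg G set0, X set0 a = 1 &
      forall (S T : {set V}) (a : asg G S), S \subset T -> #|T|%:R <= t ->
        \sum_(b : asg G (T :\: S)) X T (glue T a b) = X S a].

Definition dotv (R : realType) (d : nat) (u v : 'rV[R]_d) : R :=
  (u *m v^T) 0 0.

(* [X] is the local distribution underlying the vectors [U]. *)
Definition lasserre_solution (R : realType) (V : finType) (G : finZmodType)
    (t : R) (d : nat) (U : forall S : {set V}, asg G S -> 'rV[R]_d)
    (X : forall S : {set V}, asg G S -> R) : Prop :=
  local_distribution (2 * t) X /\
  forall (S T : {set V}) (a : asg G S) (b : asg G T),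
    #|S|%:R <= t -> #|T|%:R <= t ->
    dotv (U S a) (U T b) =
      if agree a b then X (S :|: T) (glue (S :|: T) a b) else 0.

Definition satisfies_constraint (R : realType) (G : finZmodType) (l : nat)
    (k : 'I_l -> nat) (P : forall i : 'I_l, {set {ffun 'I_(k i) -> G}})
    (V : finType) (I : csp_instance k V)
    (X : forall S : {set V}, asg G S -> R) (i : 'I_(csp_size I)) : Prop :=
  forall a : asg G (scope i),
    [ffun j => a (exist _ (cvar I i j) (cvar_scope j))] \notin P (ctype I i) ->
    X (scope i) a = 0.

Definition balanced_solution (R : realType) (V : finType) (G : finZmodType)
    (d : nat) (U : forall S : {set V}, asg G S -> 'rV[R]_d)
    (X : forall S : {set V}, asg G S -> R) : Prop :=
  forall (v : V) (g : G),
    X [set v] (asg1 v g) = dotv (U [set v] (asg1 v g)) (U [set v] (asg1 v g)) /\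
    X [set v] (asg1 v g) = 1 / #|G|%:R.

(* Main.v *)
From HB Require Import structures.
Require Import Defs.
From mathcomp Require Import all_boot all_order all_algebra.
From mathcomp Require Import cyclic separable cyclotomic zify lra.
From mathcomp Require Import reals complex.

Set Implicit Arguments.
Unset Strict Implicit.
Unset Printing Implicit Defensive.

Import Order.TTheory GRing.Theory Num.Theory.
Local Open Scope ring_scope.

(* Fourier analysis over G.  A character of G^V is a family c of characters of
   G, and the i-th constraint, a coset of a subgroup H_i, prescribes the value
   of every character annihilating H_i; by pairwise independence such a
   character is trivial or lives on at least 3 variables.  A derivation is a
   family f = (f_i) of these characters with at most s nonzero members, and it
   prescribes the value bval f for its sum tot f.  Expansion gives
   |supp (tot f)| >= |f| / 2, so on characters of small support derivations are
   closed under addition and determined by their sum.  Hence the derivations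
   with sum supported in a small set S form a group, and the local distribution
   on S is the uniform one on the assignments with the prescribed values, i.e.
   X_S(x) = |G|^-|S| sum_f e(tot f (x) - bval f).
   For the vectors, take unit vectors E_c indexed by the characters of small
   support, proportional by the phase e(- bval f) when c - d = tot f and
   orthogonal when c - d is not derivable, and let V_S(x) be the Fourier
   expansion |G|^-|S| sum_(supp c in S) e(c(x)) E_c of the indicator of x. *)

HB.instance Definition _ (T : finType) (A : finZmodType) :=
  Finite.on {ffun T -> A}.

(** Translation by [x] permutes [A], so adding [x *+ #|A|] leaves the sum of all elements
    unchanged. *)
Lemma mulrn_card (A : finZmodType) (x : A) : x *+ #|A| = 0.
Proof.
have: \sum_(y : A) y = \sum_(y : A) (y + x).
  by rewrite [LHS](reindex_inj (addIr x)).
rewrite big_split /= sumr_const => /eqP.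
by rewrite -subr_eq0 opprD addrA subrr add0r oppr_eq0 => /eqP.
Qed.

(** * Extension of characters with values in Z/(n+2) *)

Section ExtendCharacter.

Variables (A : finZmodType) (n : nat).
Local Notation Z := ('I_n.+2).
Hypothesis torsion : forall x : A, x *+ n.+2 = 0.

Let additive_on (B : {set A}) (f : A -> Z) := {in B &, {morph f : x y / x + y}}.

Lemma additive_on0 (B : {set A}) (f : A -> Z) :
  0 \in B -> additive_on B f -> f 0 = 0.
Proof. by move=> B0 fD; have := fD 0 0 B0 B0; rewrite addr0 -[LHS]addr0 => /addrI. Qed.

Lemma additive_onMn (B : {set A}) (f : A -> Z) x j :
  GRing.zmod_closed [in B] -> additive_on B f -> x \in B ->
  x *+ j \in B /\ f (x *+ j) = f x *+ j.
Proof.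
move=> clB fD Bx; have [B0 BB] := clB; have BD := GRing.zmod_closedD clB.
have [_ {}BD] := BD.
elim: j => [|j [Bj fj]]; first by rewrite !mulr0n (additive_on0 B0 fD).
split; first by rewrite mulrS; apply: BD.
by rewrite !mulrS fD // fj.
Qed.

(** Here [r] is the order of [y] modulo [B]. The extension sends b + jy to f(b) + jz; two such
    expressions of one element differ by a multiple of ry, where f(ry) = rz makes the values
    agree. *)
Lemma adjoin_character (B : {set A}) (f : A -> Z) (y : A) (r : nat) (z : Z) :
    GRing.zmod_closed [in B] -> additive_on B f ->
    (forall j, (y *+ j \in B) = (r %| j)%N) -> f (y *+ r) = z *+ r ->
  exists (B' : {set A}) (f' : A -> Z),
    [/\ GRing.zmod_closed [in B'], B \subset B', y \in B', additive_on B' f' &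
        f' y = z /\ {in B, f' =1 f}].
Proof.
move=> clB fD ry fz; have [B0 BB] := clB; have [_ BD] := GRing.zmod_closedD clB.
pose w x j := x - y *+ j \in B.
have wdef x j j' : w x j -> w x j' ->
    f (x - y *+ j) + z *+ j = f (x - y *+ j') + z *+ j'.
  wlog le_j : j j' / (j <= j')%N => [hw|] wj wj'.
    by case/orP: (leq_total j j') => h; [exact: hw | apply/esym/hw].
  have rj : (r %| j' - j)%N.
    rewrite -ry mulrnBr //.
    have -> : y *+ j' - y *+ j = (x - y *+ j) - (x - y *+ j') .
      by rewrite opprB [RHS]addrC addrA subrK.
    exact: BB.
  have yrB : y *+ r \in B by rewrite ry.
  have [q Dj] := dvdnP rj.
  have [Bq fq] := additive_onMn q clB fD yrB.
  have -> : x - y *+ j = (x - y *+ j') + y *+ r *+ q.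
    by rewrite -mulrnA mulnC -Dj mulrnBr // addrA subrK.
  rewrite fD // fq fz -mulrnA -addrA; congr (_ + _).
  by rewrite mulnC -Dj -mulrnDr subnK.
(* By torsion, multiples of [y] below n + 2 suffice, so membership in the enlarged subgroup is a
   finite search. *)
pose W x := [exists j : 'I_n.+2, w x j].
have WP x j : w x j -> W x.
  move=> wj; apply/existsP; exists (inord (j %% n.+2)).
  rewrite inordK ?ltn_mod // /w; move: wj; rewrite /w {1}(divn_eq j n.+2).
  by rewrite mulrnDr mulrnA torsion add0r.
have WE x : W x -> exists j : 'I_n.+2, w x j by exact: elimT existsP.
pose f' x := if [pick j : 'I_n.+2 | w x j] is Some j
             then f (x - y *+ j) + z *+ j else 0.
have f'E x j : w x j -> f' x = f (x - y *+ j) + z *+ j.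
  move=> wj; rewrite /f'; case: pickP => [i wi|no]; first exact: wdef.
  by have [i wi] := WE _ (WP _ _ wj); have := no i; rewrite wi.
have w0 x : x \in B -> w x 0%N by rewrite /w subr0.
have w1 : w y 1%N by rewrite /w subrr.
have wD x x' j j' : w x j -> w x' j' -> w (x + x') (j + j')%N.
  by rewrite /w mulrnDr opprD addrACA; apply: BD.
exists [set x | W x], f'; split.
- split=> [|x x']; first by rewrite inE; apply: (WP _ 0%N); exact: w0.
  rewrite !inE => /WE[j wj] /WE[j' wj'].
  apply: (WP _ (j + (n.+2 - j'))%N); rewrite /w mulrnDr mulrnBr; last first.
    by rewrite ltnW.
  rewrite torsion sub0r opprD opprK addrACA.
  have -> : - x' + y *+ j' = - (x' - y *+ j') by rewrite opprB addrC.
  exact: BB.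
- by apply/subsetP => x Bx; rewrite inE; apply/WP/w0.
- by rewrite inE; apply: WP w1.
- move=> x x'; rewrite !inE => /WE[j wj] /WE[j' wj'].
  rewrite (f'E _ _ wj) (f'E _ _ wj') (f'E _ _ (wD _ _ _ _ wj wj')).
  rewrite mulrnDr opprD addrACA fD // mulrnDr; exact: addrACA.
split; first by rewrite (f'E _ _ w1) subrr (additive_on0 B0 fD) add0r.
by move=> x Bx; rewrite (f'E _ _ (w0 _ Bx)) subr0 addr0.
Qed.

(** Take the least r > 0 with ry in [B]. Division with remainder gives the equivalence; torsion
    gives existence and r | n + 2. *)
Lemma order_mod (B : {set A}) (y : A) : GRing.zmod_closed [in B] ->
  exists2 r : nat, (r %| n.+2)%N & forall j, (y *+ j \in B) = (r %| j)%N.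
Proof.
move=> clB; have [B0 BB] := clB; have [_ BD] := GRing.zmod_closedD clB.
have BM x j : x \in B -> x *+ j \in B.
  by move=> Bx; elim: j => [|j ih]; rewrite ?mulr0n // mulrS BD.
have exr : exists r, (0 < r)%N && (y *+ r \in B).
  by exists n.+2; rewrite torsion.
case: (ex_minnP exr) => r /andP[r0 Br] rmin.
have ry j : (y *+ j \in B) = (r %| j)%N.
  apply/idP/dvdnP => [Bj|[q ->]]; last by rewrite mulnC mulrnA BM.
  exists (j %/ r)%N; apply/eqP; rewrite eq_sym -(eqn_add2r (j %% r)) -divn_eq.
  rewrite -[X in X == _]addn0 eqn_add2l eq_sym eqn0Ngt; apply/negP => h.
  have: (r <= j %% r)%N.
    apply: rmin; rewrite h /=.
    have -> : y *+ (j %% r) = y *+ j - y *+ r *+ (j %/ r).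
      by rewrite [in X in X - _](divn_eq j r) mulrnDr mulnC mulrnA addrC addKr.
    by apply: BB => //; exact: BM.
  by rewrite leqNgt ltn_mod r0.
by exists r => //; rewrite -ry torsion.
Qed.

(** Induction on the size of the complement of [B], adjoining one missing element at a time. *)
Lemma extend_character (B : {set A}) (f : A -> Z) :
    GRing.zmod_closed [in B] -> additive_on B f ->
  exists2 f' : A -> Z, {morph f' : x y / x + y} & {in B, f' =1 f}.
Proof.
have [m] := ubnP #|~: B|; elim: m => // m IHm in B f *.
rewrite ltnS => leB clB fD.
have [/forallP BT|/forallPn[y By]] := boolP [forall y, y \in B].
  by exists f => // x y; apply: fD; exact: BT.
have [r /dvdnP[q Dn] ry] := order_mod y clB.
have yrB : y *+ r \in B by rewrite ry.
have r0 : (0 < r)%N by rewrite lt0n; apply/eqP => r0; rewrite r0 muln0 in Dn.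
have q0 : (0 < q)%N by rewrite lt0n; apply/eqP => r0'; rewrite r0' in Dn.
set c := f (y *+ r).
have [_ fq] := additive_onMn q clB fD yrB.
(* f(ry) is divisible by r: with n + 2 = qr, the element q f(ry) = f((n+2)y) is 0 in Z/(n+2), so qr
   divides q f(ry) as integers. *)
have /dvdnP[z Dz] : (r %| c)%N.
  rewrite -(dvdn_pmul2l q0) -Dn.
  move: fq; rewrite -mulrnA [(r * q)%N]mulnC -Dn torsion (additive_on0 clB.1 fD).
  rewrite -/c -[c in RHS]natr_Zp -mulrnA => h0.
  have := congr1 (@nat_of_ord n.+2) h0. 
  by rewrite (@val_Zp_nat n.+2) // mulnC /dvdn => <-.
have [|B' [f' [clB' sBB' B'y f'D [_ f'f]]]] :=
  @adjoin_character B f y r z%:R clB fD ry.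
  by rewrite -mulrnA -Dz -/c natr_Zp.
have [|||g gD gf'] := IHm B' f' => //.
  apply: leq_trans leB; apply: proper_card; rewrite properEneq setCS sBB'.
  rewrite andbT; apply: contraNneq By => /setC_inj <-; exact: B'y.
by exists g => // x Bx; rewrite gf' ?f'f // (subsetP sBB').
Qed.

(** The zero character of [B] is extended by sending [a] to q = (n+2)/r, an element of order r in
    Z/(n+2). It is nonzero because r = 1 would put [a] in [B]. *)
Lemma separating_character (B : {set A}) (a : A) :
    GRing.zmod_closed [in B] -> a \notin B ->
  exists f : A -> Z,
    [/\ {morph f : x y / x + y}, {in B, forall x, f x = 0} & f a != 0].
Proof.
move=> clB Ba; have [r /dvdnP[q Dn] ry] := order_mod a clB.
have f0D : additive_on B (fun=> 0) by move=> x y _ _; rewrite addr0.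
have [|B' [f' [clB' sBB' B'a f'D [f'a f'0]]]] :=
  @adjoin_character B (fun=> 0) a r q%:R clB f0D ry.
  by rewrite -mulrnA -Dn; apply: val_inj; rewrite [RHS](@val_Zp_nat n.+2) // modnn.
have [g gD gf'] := extend_character clB' f'D.
exists g; split=> // [x Bx|]; first by rewrite gf' ?f'0 // (subsetP sBB').
rewrite gf' // f'a; apply: contra Ba => /eqP/(congr1 val).
rewrite /= (@val_Zp_nat n.+2) //= => /eqP; rewrite -/(dvdn _ _) Dn => h.
have q0 : (0 < q)%N by rewrite lt0n; apply/eqP => q0; rewrite q0 in Dn.
by rewrite -[a]mulr1n ry -(dvdn_pmul2l q0) muln1.
Qed.

End ExtendCharacter.

(** * Roots of unity and character sums *)

Section RootsOfUnity.

Variable C : numClosedFieldType.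

(** X^n - 1 is separable, so it has n distinct roots, and n distinct n-th roots of unity include a
    primitive one. *)
Lemma prim_root_exists n : (0 < n)%N -> exists w : C, n.-primitive_root w.
Proof.
pose p : {poly C} := 'X^n - 1; have [r Dp] := closed_field_poly_normal p.
move=> n_gt0; rewrite (monicP _) ?monicXnsubC // scale1r in Dp.
have rn1 : all n.-unity_root r by apply/allP=> z; rewrite -root_prod_XsubC -Dp.
have sz_r : (n < (size r).+1)%N.
  by rewrite -(size_prod_XsubC r id) -Dp size_XnsubC.
have [|z] := hasP (has_prim_root n_gt0 rn1 _ sz_r); last by exists z.
by rewrite -separable_prod_XsubC -Dp separable_Xn_sub_1 // pnatr_eq0 -lt0n.
Qed.

Variables (n : nat) (w : C).
Hypothesis w_prim : n.+2.-primitive_root w.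
Local Notation Z := ('I_n.+2).

Definition expz (z : Z) : C := w ^+ z.

Lemma expzD x y : expz (x + y) = expz x * expz y.
Proof. by rewrite /expz /= (prim_expr_mod w_prim) exprD. Qed.

Lemma expz0 : expz 0 = 1.
Proof. by rewrite /expz expr0. Qed.

Lemma expzNK x : expz (- x) * expz x = 1.
Proof. by rewrite -expzD addNr expz0. Qed.

Lemma expz_neq0 x : expz x != 0.
Proof.
by apply/eqP => h; have /eqP := expzNK x; rewrite h mulr0 eq_sym oner_eq0.
Qed.

Lemma expz_eq1 x : expz x = 1 -> x = 0.
Proof.
move/eqP; rewrite -(prim_order_dvd w_prim) => h; apply: val_inj => /=.
by move: h; rewrite /dvdn modn_small // => /eqP.
Qed.

Lemma expz_conj x : (expz x)^* = expz (- x).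
Proof.
have n1 : `|expz x| = 1.
  apply/eqP; rewrite -(pexpr_eq1 (n := n.+2)) //= -normrX /expz -exprM mulnC.
  by rewrite exprM (prim_expr_order w_prim) expr1n normr1.
apply: (mulIf (expz_neq0 x)); rewrite expzNK mulrC -normCK n1; exact: expr1n.
Qed.

(** If f(a) is nonzero for some a in [B], translation by a multiplies the sum by e(f(a)), which is
    not 1, so the sum is zero. *)
Lemma sum_expz (A : finZmodType) (B : {set A}) (f : A -> Z) :
    GRing.zmod_closed [in B] -> {in B &, {morph f : x y / x + y}} ->
  \sum_(x in B) expz (f x) = if [forall x in B, f x == 0] then #|B|%:R else 0.
Proof.
move=> clB fD; have [B0 BB] := clB; have [_ BD] := GRing.zmod_closedD clB.
case: forall_inP => [f0|/forall_inP].
  rewrite -sumr_const; apply: eq_bigr => x Bx.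
  by rewrite (eqP (f0 _ Bx)) expz0.
rewrite negb_forall_in => /exists_inP[a Ba fa].
set S := \sum_(_ in _) _.
have: expz (f a) * S = S.
  rewrite mulr_sumr /S [RHS](reindex_inj (addrI a)) /=.
  apply: eq_big => x; last by move=> Bx; rewrite -expzD fD.
  apply/idP/idP => [|h]; first exact: BD.
  by rewrite -[x](addKr a) addrC; apply: BB.
move/eqP; rewrite -[X in _ == X]mul1r -subr_eq0 -mulrBl mulf_eq0 => /orP[|/eqP//].
by rewrite subr_eq0 => /eqP/expz_eq1/eqP; rewrite (negPf fa).
Qed.

Lemma sum_expzT (A : finZmodType) (f : A -> Z) : {morph f : x y / x + y} ->
  \sum_(x : A) expz (f x) = if [forall x, f x == 0] then #|A|%:R else 0.
Proof.
move=> fD; rewrite -cardsT; under eq_bigl => x do rewrite -[true](in_setT x).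
rewrite sum_expz => [|| x y _ _]; last exact: fD; last first.
  by split=> [|x y]; rewrite !inE.
by congr (if _ then _ else _); apply/forall_inP/forallP => h x; [apply: h|].
Qed.

End RootsOfUnity.

(** * The dual group *)

Section Dual.

Variables (n : nat) (G : finZmodType).
Local Notation Z := ('I_n.+2).

Definition additive_ffun : pred {ffun G -> Z} :=
  fun f => [forall x, forall y, f (x + y) == f x + f y].

Lemma additive_ffun_closed : GRing.zmod_closed additive_ffun.
Proof.
have P (f : {ffun G -> Z}) : reflect {morph f : x y / x + y} (f \in additive_ffun).
  apply: (iffP forallP) => [h x y|h x]; first by have /forallP/(_ y)/eqP := h x.
  by apply/forallP => y; rewrite h.
split; first by apply/P => x y; rewrite !ffunE addr0.
by move=> f g /P fD /P gD; apply/P => x y; rewrite !ffunE fD gD opprD addrACA.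
Qed.

HB.instance Definition _ :=
  GRing.isZmodClosed.Build {ffun G -> Z} additive_ffun additive_ffun_closed.

(** Bundling makes the characters a [finZmodType] themselves, so that [sum_expz] also evaluates sums
    over characters. *)
Record dual :=
  Dual { dual_val :> {ffun G -> Z}; dual_valP : dual_val \in additive_ffun }.

HB.instance Definition _ := [isSub for dual_val].
HB.instance Definition _ := [Finite of dual by <:].
HB.instance Definition _ := [SubChoice_isSubZmodule of dual by <:].

Lemma dualDr (c : dual) : {morph c : x y / x + y}.
Proof. by move=> x y; have /forallP/(_ x)/forallP/(_ y)/eqP := dual_valP c. Qed.

Lemma dualDl (c d : dual) x : (c + d) x = c x + d x.
Proof. by rewrite ffunE. Qed.

Lemma dual0l x : (0 : dual) x = 0.
Proof. by rewrite ffunE. Qed.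

Lemma dual0r (c : dual) : c 0 = 0.
Proof. by have := dualDr c 0 0; rewrite addr0 -[LHS]addr0 => /addrI. Qed.

Lemma dual_eq0P (c : dual) : reflect (forall x, c x = 0) (c == 0).
Proof.
apply: (iffP eqP) => [-> x|h]; first exact: dual0l.
by apply/val_inj/ffunP => x; rewrite [LHS]h [RHS]dual0l.
Qed.

Lemma dual_of_morph (f : G -> Z) :
  {morph f : x y / x + y} -> exists c : dual, c =1 f.
Proof.
move=> fD; have h : finfun f \in additive_ffun.
  by apply/forallP => x; apply/forallP => y; rewrite !ffunE fD.
by exists (Dual h) => x; rewrite ffunE.
Qed.

Hypothesis cardG : (#|G| %| n.+2)%N.

Lemma dual_torsion (x : G) : x *+ n.+2 = 0.
Proof. by have /dvdnP[q ->] := cardG; rewrite mulnC mulrnA mulrn_card mul0rn. Qed.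

Lemma dual_separates (x : G) : x != 0 -> exists c : dual, c x != 0.
Proof.
move=> x0; have [||f [fD _ fx]] := @separating_character G n dual_torsion [set 0] x.
- by split=> [|y z]; rewrite !inE // => /eqP-> /eqP->; rewrite subrr.
- by rewrite inE.
by have [c cf] := dual_of_morph fD; exists c; rewrite cf.
Qed.

End Dual.

(** * Pairing of G^V with its characters *)

Section Pairing.

Variables (n : nat) (G : finZmodType) (V : finType).
Local Notation Z := ('I_n.+2).
Local Notation D := (dual n G).

Definition pairing (T : finType) (c : {ffun T -> D}) (x : {ffun T -> G}) : Z :=
  \sum_v c v (x v).

Lemma pairingDl (T : finType) (c d : {ffun T -> D}) x :
  pairing (c + d) x = pairing c x + pairing d x.
Proof. by rewrite -big_split; apply: eq_bigr => v _; rewrite ffunE dualDl. Qed.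

Lemma pairingDr (T : finType) (c : {ffun T -> D}) x y :
  pairing c (x + y) = pairing c x + pairing c y.
Proof. by rewrite -big_split; apply: eq_bigr => v _; rewrite ffunE dualDr. Qed.

Lemma pairing0l (T : finType) (x : {ffun T -> G}) : pairing 0 x = 0.
Proof. by rewrite /pairing big1 // => v _; rewrite ffunE dual0l. Qed.

Lemma pairing0r (T : finType) (c : {ffun T -> D}) : pairing c 0 = 0.
Proof. by rewrite /pairing big1 // => v _; rewrite ffunE dual0r. Qed.

Lemma pairingNl (T : finType) (c : {ffun T -> D}) x : pairing (- c) x = - pairing c x.
Proof. by apply/eqP; rewrite -addr_eq0 -pairingDl addNr pairing0l. Qed.

Lemma pairingNr (T : finType) (c : {ffun T -> D}) x : pairing c (- x) = - pairing c x.
Proof. by apply/eqP; rewrite -addr_eq0 -pairingDr addNr pairing0r. Qed.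

Definition supp (c : {ffun V -> D}) : {set V} := [set v | c v != 0].

Lemma suppP (c : {ffun V -> D}) (S : {set V}) :
  reflect (forall v, v \notin S -> c v = 0) (supp c \subset S).
Proof.
apply: (iffP subsetP) => h v.
  by apply: contraNeq => cv; apply: h; rewrite inE.
by rewrite inE; apply: contraNT => /h ->.
Qed.

Lemma supp0 : supp 0 = set0.
Proof. by apply/setP => v; rewrite !inE ffunE eqxx. Qed.

Lemma suppN c : supp (- c) = supp c.
Proof. by apply/setP => v; rewrite !inE ffunE oppr_eq0. Qed.

Lemma suppD c d : supp (c + d) \subset supp c :|: supp d.
Proof.
apply/suppP => v; rewrite !inE !negb_or !negbK ffunE => /andP[/eqP-> /eqP->].
by rewrite addr0.
Qed.

Lemma supp_closed (S : {set V}) : GRing.zmod_closed [in [set c | supp c \subset S]].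
Proof.
split=> [|c d]; rewrite !inE ?supp0 ?sub0set // => cS dS.
by apply: subset_trans (suppD _ _) _; rewrite suppN subUset cS.
Qed.

Lemma eq_pairing (c : {ffun V -> D}) (x y : {ffun V -> G}) :
  {in supp c, x =1 y} -> pairing c x = pairing c y.
Proof.
move=> xy; apply: eq_bigr => v _.
have [->|cv] := eqVneq (c v) 0; first by rewrite !dual0l.
by rewrite xy // inE.
Qed.

Definition single (T : finType) (A : zmodType) (v : T) (a : A) : {ffun T -> A} :=
  [ffun u => if u == v then a else 0].

Lemma pairing_single_r (T : finType) (c : {ffun T -> D}) v g :
  pairing c (single v g) = c v g.
Proof.
rewrite /pairing (bigD1 v) //= big1 ?addr0 ?ffunE ?eqxx // => u uv.
by rewrite ffunE (negPf uv) dual0r.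
Qed.

Lemma pairing_single_l (T : finType) (x : {ffun T -> G}) v (d : D) :
  pairing (single v d) x = d (x v).
Proof.
rewrite /pairing (bigD1 v) //= big1 ?addr0 ?ffunE ?eqxx // => u uv.
by rewrite ffunE (negPf uv) dual0l.
Qed.

(** * Orthogonality relations *)

Section Orthogonality.

Variables (C : numClosedFieldType) (w : C).
Hypothesis w_prim : n.+2.-primitive_root w.
Hypothesis cardG : (#|G| %| n.+2)%N.

Local Notation e := (expz w).

(** Sum e(c(x)) over all pairs in both orders: only x = 0 contributes in one order, since characters
    separate points, and only c = 0 in the other. *)
Lemma card_dual : #|{: D}| = #|G|.
Proof.
have sG (c : D) : \sum_(x : G) e (c x) = if c == 0 then #|G|%:R else 0.
  rewrite (sum_expzT w_prim (dualDr c)); congr (if _ then _ else _).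
  by apply/forallP/dual_eq0P => h x; apply/eqP.
have sD (x : G) : \sum_(c : D) e (c x) = if x == 0 then #|{: D}|%:R else 0.
  rewrite (sum_expzT w_prim (f := fun c : D => c x)) => [|c d]; last exact: dualDl.
  congr (if _ then _ else _); apply/forallP/eqP => [h|-> c].
    apply/eqP; apply: contraT => /(dual_separates cardG)[c].
    by rewrite (eqP (h c)) eqxx.
  by rewrite dual0r.
have : \sum_(x : G) \sum_(c : D) e (c x) = \sum_(c : D) \sum_(x : G) e (c x).
  exact: exchange_big.
rewrite (eq_bigr _ (fun x _ => sD x)) (eq_bigr _ (fun c _ => sG c)).
rewrite -!big_mkcond !big_pred1_eq => /eqP.
by rewrite eqr_nat => /eqP.
Qed.

Lemma sum_supp_sub (S : {set V}) (x : {ffun V -> G}) :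
  \sum_(c : {ffun V -> D} | supp c \subset S) e (pairing c x) =
  if [forall v in S, x v == 0] then (#|G| ^ #|S|)%:R else 0.
Proof.
have := @sum_expz C n w w_prim {ffun V -> D} [set c | supp c \subset S]
  (fun c => pairing c x) (supp_closed S) (fun c d _ _ => pairingDl c d x).
under eq_bigl do rewrite inE.
move=> ->; congr (if _ then _ else _).
  apply/forall_inP/forall_inP => [h v vS|h c].
    (* If x(v) is nonzero, some character supported at [v] alone is nontrivial on [x]. *)
    apply: contraT => /(dual_separates cardG)[d].
    have := h (single v d); rewrite pairing_single_l => /(_ _)/eqP-> //.
    rewrite inE; apply/suppP => u uS; rewrite ffunE.
    by case: eqP => // uv; rewrite uv vS in uS.
  rewrite inE => cS; rewrite (@eq_pairing c x 0) ?pairing0r // => v cv.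
  by rewrite ffunE; apply/eqP/h/(subsetP cS).
(* The characters supported in [S] are counted as functions from [S] to the dual, which has |G|
   elements. *)
congr (_%:R); rewrite -card_dual -(card_pffun_on (0 : D)) cardsE.
apply: eq_card => c; rewrite unfold_in.
apply/suppP/pffun_onP => [cS|[/subsetP cS _] v vS].
  split=> //; apply/subsetP => v; rewrite inE.
  by apply: contraR => /cS ->.
by apply: contraNeq vS => cv; apply: cS; rewrite inE.
Qed.

(** Extension by zero places assignments on different sets in the single group G^V, where characters
    act. *)
Definition extend (S : {set V}) (a : asg G S) : {ffun V -> G} :=
  [ffun v => if (insub v : option {u | u \in S}) is Some u then a u else 0].

Lemma extendE (S : {set V}) (a : asg G S) (u : {u | u \in S}) :
  extend a (val u) = a u.
Proof. by rewrite ffunE valK. Qed.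

Lemma extend_out (S : {set V}) (a : asg G S) v : v \notin S -> extend a v = 0.
Proof. by move=> vS; rewrite ffunE insubN. Qed.

Lemma extendD (S : {set V}) (a b : asg G S) : extend (a + b) = extend a + extend b.
Proof.
by apply/ffunP => v; rewrite !ffunE; case: insubP => [u _ _|]; rewrite ?ffunE ?addr0.
Qed.

(** Counterpart of [sum_supp_sub] with assignments and characters exchanged: a character nonzero at
    some v in [S] is detected by assignments supported at v. *)
Lemma sum_asg (S : {set V}) (c : {ffun V -> D}) :
  \sum_(a : asg G S) e (pairing c (extend a)) =
  if [forall v in S, c v == 0] then (#|G| ^ #|S|)%:R else 0.
Proof.
have fD (a b : asg G S) :
    pairing c (extend (a + b)) = pairing c (extend a) + pairing c (extend b).
  by rewrite extendD pairingDr.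
rewrite (sum_expzT w_prim fD).
congr (if _ then _ else _); last by rewrite card_ffun card_sig.
apply/forallP/forall_inP => [h v vS|h a].
  apply/dual_eq0P => g.
  have := h [ffun u => if val u == v then g else 0].
  move/eqP <-; rewrite -pairing_single_r.
  congr pairing; apply/ffunP => u; rewrite !ffunE.
  case: insubP => [u' _ <-|uS]; first by rewrite ffunE.
  by case: eqP => // uv; rewrite uv vS in uS.
rewrite (@eq_pairing c _ 0) ?pairing0r // => v; rewrite inE => cv.
by rewrite [RHS]ffunE extend_out //; apply: contra cv; apply: h.
Qed.

End Orthogonality.
End Pairing.

(** * Derivations and expansion *)

Lemma double_count (I J : finType) (K : {set I}) (r : I -> pred J) :
  (\sum_j #|[set i in K | r i j]| = \sum_(i in K) #|[set j | r i j]|)%N.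
Proof.
have E (T : finType) (p : pred T) : #|[set t | p t]| = (\sum_(t | p t) 1)%N.
  by rewrite -sum1dep_card.
under eq_bigr do rewrite E big_mkcondr.
rewrite exchange_big; apply: eq_bigr => i _.
by rewrite E [RHS]big_mkcond.
Qed.

Section Derivations.

Variables (n : nat) (G : finZmodType) (V J : finType).
Local Notation Z := ('I_n.+2).
Local Notation D := (dual n G).
(** In the application [sc i] is a scope, [Du i] the characters annihilating the i-th subgroup, and
    [m] the integer part of s. The hypothesis [expand] is expansion with slack 5/4 per constraint,
    cleared of denominators. *)
Variables (sc : J -> {set V}) (Du : J -> {set {ffun V -> D}}) (m : nat).
Hypothesis Du_closed : forall i, GRing.zmod_closed [in Du i].
Hypothesis Du_supp : forall i c, c \in Du i -> supp c \subset sc i.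
Hypothesis Du_ge3 : forall i c, c \in Du i -> c != 0 -> (3 <= #|supp c|)%N.
Hypothesis expand : forall A : {set J}, (#|A| <= m)%N ->
  (4 * \sum_(i in A) #|sc i| <= 4 * #|\bigcup_(i in A) sc i| + 5 * #|A|)%N.

Local Notation F := {ffun J -> {ffun V -> D}}.

Definition active (f : F) : {set J} := [set i | f i != 0].
Definition tot (f : F) : {ffun V -> D} := \sum_i f i.
Definition derivation (f : F) : bool :=
  [forall i, f i \in Du i] && (#|active f| <= m)%N.

Lemma tot_ffunE f v : tot f v = \sum_i f i v.
Proof. by rewrite /tot sum_ffunE. Qed.

Lemma totD f g : tot (f + g) = tot f + tot g.
Proof. by rewrite -big_split; apply: eq_bigr => i _; rewrite ffunE. Qed.

Lemma totN f : tot (- f) = - tot f.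
Proof. by rewrite -[RHS]sumrN; apply: eq_bigr => i _; rewrite ffunE. Qed.

Lemma activeN f : active (- f) = active f.
Proof. by apply/setP => i; rewrite !inE ffunE oppr_eq0. Qed.

Lemma activeD f g : active (f + g) \subset active f :|: active g.
Proof.
apply/subsetP => i; rewrite !inE ffunE -negb_and; apply: contra.
by case/andP => /eqP -> /eqP ->; rewrite addr0.
Qed.

Lemma active_eq0 f : #|active f| = 0%N -> f = 0.
Proof.
move/cards0_eq/setP => h; apply/ffunP => i; rewrite ffunE.
by have := h i; rewrite !inE => /negbFE/eqP.
Qed.

Lemma derivationB f g : derivation f -> derivation g ->
  (#|active f| + #|active g| <= m)%N ->
  derivation (f - g).
Proof.
move=> /andP[/forallP fD _] /andP[/forallP gD _] le_m; apply/andP; split.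
  by apply/forallP => i; rewrite !ffunE; apply: (Du_closed i).2.
apply: leq_trans le_m; apply: leq_trans (subset_leq_card (activeD _ _)) _.
by rewrite activeN leq_card_setU.
Qed.

Lemma derivation0 : derivation 0.
Proof.
apply/andP; split; first by apply/forallP => i; rewrite ffunE (Du_closed i).1.
suff -> : active 0 = set0 by rewrite cards0.
by apply/setP => i; rewrite !inE ffunE eqxx.
Qed.

Lemma derivationN f : derivation f -> derivation (- f).
Proof.
move=> fd; rewrite -[- f]add0r; apply: derivationB => //; first exact: derivation0.
have /andP[_ le_m] := fd; apply: leq_trans le_m.
suff -> : active 0 = set0 by rewrite cards0.
by apply/setP => i; rewrite !inE ffunE eqxx.
Qed.

(* A variable lying in exactly one of the active supports survives in the
   total; every other incidence is charged to the expansion defect. *)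
Lemma incidence_bound f : derivation f ->
  (\sum_(i in active f) #|supp (f i)| + 2 * #|\bigcup_(i in active f) sc i| <=
     #|supp (tot f)| + 2 * \sum_(i in active f) #|sc i|)%N.
Proof.
case/andP => /forallP fD _; set K := active f; set U := \bigcup_(i in K) sc i.
have E (A : {set V}) : #|A| = (\sum_v (v \in A))%N.
  by rewrite -sum1_card big_mkcond; apply: eq_bigr => v _; case: (v \in A).
have -> : (\sum_(i in K) #|sc i| = \sum_v #|[set i in K | v \in sc i]|)%N.
  rewrite double_count; apply: eq_bigr => i _; apply: eq_card => v.
  by rewrite inE.
rewrite -(double_count K (fun i v => f i v != 0)) (E U) (E (supp _)).
rewrite !big_distrr -!big_split /=; apply: leq_sum => v _.
set dv := [set i in K | f i v != 0]; set cv := [set i in K | v \in sc i].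
have sub_dc : dv \subset cv.
  apply/subsetP => i; rewrite !inE => /andP[-> fv] /=.
  by apply: (subsetP (Du_supp (fD i))); rewrite inE.
have le_dc := subset_leq_card sub_dc.
have Ucv : (v \in U) = (0 < #|cv|)%N.
  apply/bigcupP/card_gt0P => [[i iK iv]|]; first by exists i; rewrite inE iK.
  by case=> i; rewrite inE => /andP[]; exists i.
have d1 : #|dv| = 1%N -> v \in supp (tot f).
  move/eqP/cards1P => [i Di]; have: i \in dv by rewrite Di inE.
  rewrite !inE => /andP[_ fv]; rewrite tot_ffunE (bigD1 i) //= big1 ?addr0 // => j ji.
  have: j \notin dv by rewrite Di inE.
  rewrite !inE negb_and !negbK => /orP[/eqP->|/eqP//].
  by rewrite ffunE.
(* Remaining claim at [v]: |dv| + 2[cv nonempty] is at most [v in supp] + 2|cv|. As |dv| <= |cv|, it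
   could fail only for |dv| = |cv| = 1, where [d1] gives the missing unit. *)
rewrite Ucv; move: (_ \in supp _) d1 le_dc => [] d1 le_dc; last first.
  have: #|dv| != 1%N by apply/eqP => /d1.
  by lia.
by lia.
Qed.

(** [E] is the expansion defect, total scope size minus size of the union. Each active character
    contributes at least 3 incidences to [incidence_bound]. Eliminating [E] yields [active_le];
    keeping it integral yields the sharper [supp_tot_ge2]. *)
Lemma derivation_defect f : derivation f -> exists2 E : nat,
  (3 * #|active f| <= #|supp (tot f)| + 2 * E)%N & (4 * E <= 5 * #|active f|)%N.
Proof.
move=> fd; have := incidence_bound fd; have /andP[/forallP fD le_m] := fd.
have := expand le_m; set s := (\sum_(i in _) #|sc i|)%N; set u := #|\bigcup_(i in _) _|.
have : (\sum_(i in active f) 3 <= \sum_(i in active f) #|supp (f i)|)%N.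
  by apply: leq_sum => i; rewrite inE => fi; exact: Du_ge3 (fD i) fi.
rewrite sum_nat_const; set t := (\sum_(i in _) _)%N => h1 h2 h3.
by exists (s - u)%N; lia.
Qed.

Lemma active_le f : derivation f -> (#|active f| <= 2 * #|supp (tot f)|)%N.
Proof. by move=> /derivation_defect[E]; lia. Qed.

(** Nothing nontrivial is derivable about a single variable, which is what makes the solution
    balanced. *)
Lemma supp_tot_ge2 f : derivation f -> f != 0 -> (2 <= #|supp (tot f)|)%N.
Proof.
move=> fd f0; have [E h1 h2] := derivation_defect fd.
(* A single active constraint gets only the bound 1 from the defect, but then the total is its own
   character, with support at least 3. From two on, integrality of [E] gives 2. *)
have [a1|a1] := eqVneq #|active f| 1%N; last first.
  have : #|active f| != 0%N by apply: contraNneq f0 => /active_eq0 ->.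
  by lia.
have /eqP/cards1P[i Ai] := a1; have iA : i \in active f by rewrite Ai inE.
have -> : tot f = f i.
  rewrite /tot (bigD1 i) //= big1 ?addr0 // => j ji.
  have : j \notin active f by rewrite Ai inE.
  by rewrite inE negbK => /eqP.
have /andP[/forallP fD _] := fd; rewrite inE in iA.
exact: ltnW (Du_ge3 (fD i) iA).
Qed.

(** Each derivation has at most 2|supp| active constraints, so f - g has at most 4|supp| <= m and is
    again a derivation. Its total is zero, hence [active_le] leaves it no active constraint. *)
Lemma tot_inj f g : derivation f -> derivation g -> tot f = tot g ->
  (4 * #|supp (tot f)| <= m)%N -> f = g.
Proof.
move=> fd gd fg le_m; have := active_le fd; have := active_le gd.
rewrite -fg => hg hf; have fgd : derivation (f - g) by apply: derivationB => //; lia.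
have := active_le fgd; rewrite totD totN fg subrr supp0 cards0 muln0 leqn0.
by move=> /eqP/active_eq0/eqP; rewrite subr_eq0 => /eqP.
Qed.

Definition derivations (S : {set V}) : {set F} :=
  [set f | derivation f & supp (tot f) \subset S].

Lemma derivations_closed (S : {set V}) : (4 * #|S| <= m)%N ->
  GRing.zmod_closed [in derivations S].
Proof.
move=> le_m; split=> [|f g].
  rewrite inE derivation0 /= /tot big1 ?supp0 ?sub0set // => i _; exact: ffunE.
rewrite !inE => /andP[fd fS] /andP[gd gS].
have := active_le fd; have := active_le gd.
have := subset_leq_card fS; have := subset_leq_card gS => h1 h2 h3 h4.
rewrite derivationB //=; last by lia.
rewrite totD totN; apply: subset_trans (suppD _ _) _.
by rewrite suppN subUset fS.
Qed.

Lemma derivations_trivial (S : {set V}) : (#|S| <= 1)%N -> derivations S = [set 0].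
Proof.
move=> S1; apply/setP => f; rewrite !inE; apply/andP/eqP => [[fd fS]|->].
  apply: contraTeq S1 => f0; rewrite -ltnNge.
  exact: leq_trans (supp_tot_ge2 fd f0) (subset_leq_card fS).
split; first exact: derivation0.
by rewrite /tot big1 ?supp0 ?sub0set // => i _; exact: ffunE.
Qed.

End Derivations.

(** * The local distributions and their vectors *)

Lemma card_zmod_gt0 (G : finZmodType) : (0 < #|G|)%N.
Proof. by apply/card_gt0P; exists 0. Qed.

Lemma card_zmodX_neq0 (R : numDomainType) (G : finZmodType) k :
  (#|G| ^ k)%:R != 0 :> R.
Proof. by rewrite pnatr_eq0 expn_eq0 negb_and -lt0n card_zmod_gt0. Qed.

(* Choose a representative in each class of the relation [K x y != 0]; the
   vector of [x] sits on the coordinate of its representative. *)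
Lemma block_gram (T : finType) (C : numClosedFieldType) (K : T -> T -> C)
    (A : pred T) :
    (forall x, A x -> K x x = 1) ->
    (forall x y, A x -> A y -> K y x = (K x y)^*) ->
    (forall x y z, A x -> A y -> A z -> K x y != 0 -> K x z = K x y * K y z) ->
  exists E : T -> T -> C,
    forall x y, A x -> A y -> \sum_r E x r * (E y r)^* = K x y.
Proof.
move=> K1 Kc KM; pose rep x := odflt x [pick r | A r && (K x r != 0)].
have repP x : A x -> A (rep x) && (K x (rep x) != 0).
  move=> Ax; rewrite /rep; case: pickP => //= /(_ x).
  by rewrite Ax K1 // oner_eq0.
exists (fun x r => if r == rep x then K x r else 0) => x y Ax Ay.
have /andP[Ar Kxr] := repP x Ax; have /andP[As Kyr] := repP y Ay.
rewrite (bigD1 (rep x)) //= big1 ?addr0 ?eqxx => [|r /negPf ->]; last by rewrite mul0r.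
case: eqP => [Dr|ne]; first by rewrite -Kc // -KM.
(* If [x] and [y] were related, they would be related to the same elements, and both choices of
   representative would coincide. *)
rewrite conjC0 mulr0; apply/esym/eqP; apply: contra_notT ne => Kxy.
have Kyx : K y x != 0 by rewrite Kc // conjC_eq0.
rewrite /rep (_ : [pick r | _] = [pick r | A r && (K y r != 0)]).
  by case: pickP => //= /(_ y); rewrite Ay K1 ?oner_eq0.
apply: eq_pick => r; case Arr: (A r) => //=; apply/idP/idP => h.
  by rewrite (KM y x r) // mulf_neq0.
by rewrite (KM x y r) // mulf_neq0.
Qed.

Section FourierSolution.

Variables (n : nat) (G : finZmodType) (V J : finType).
Local Notation Z := ('I_n.+2).
Local Notation D := (dual n G).
Variables (C : numClosedFieldType) (w : C).
Hypothesis w_prim : n.+2.-primitive_root w.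
Local Notation e := (expz w).

Variables (sc : J -> {set V}) (Du : J -> {set {ffun V -> D}}) (m : nat).
Hypothesis Du_closed : forall i, GRing.zmod_closed [in Du i].
Hypothesis Du_supp : forall i c, c \in Du i -> supp c \subset sc i.
Hypothesis Du_ge3 : forall i c, c \in Du i -> c != 0 -> (3 <= #|supp c|)%N.
Hypothesis expand : forall A : {set J}, (#|A| <= m)%N ->
  (4 * \sum_(i in A) #|sc i| <= 4 * #|\bigcup_(i in A) sc i| + 5 * #|A|)%N.

Variable pt : J -> {ffun V -> G}.

Local Notation F := {ffun J -> {ffun V -> D}}.
Local Notation derivation := (derivation Du m).
Local Notation derivations := (derivations Du m).

(** A character in [Du i] is constant on the i-th coset; [pt i] is a point of that coset, extended
    to [V], at which the constant is read off. *)
Definition bval (f : F) : Z := \sum_i pairing (f i) (pt i).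

Lemma bvalD f g : bval (f + g) = bval f + bval g.
Proof. by rewrite -big_split; apply: eq_bigr => i _; rewrite ffunE pairingDl. Qed.

Lemma bvalN f : bval (- f) = - bval f.
Proof. by rewrite -sumrN; apply: eq_bigr => i _; rewrite ffunE pairingNl. Qed.

(** [x] assigns all of [V], but only its values on [S] matter ([eq_mu]); this lets marginals on
    different sets share one argument. *)
Definition mu (S : {set V}) (x : {ffun V -> G}) : C :=
  (#|G| ^ #|S|)%:R^-1 * \sum_(f in derivations S) e (pairing (tot f) x - bval f).

Lemma phaseD x f g : pairing (tot (f + g)) x - bval (f + g) =
  (pairing (tot f) x - bval f) + (pairing (tot g) x - bval g).
Proof. by rewrite totD pairingDl bvalD opprD addrACA. Qed.

(** The derivations of a small set form a group on which the phase is additive, so the sum is zero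
    or the group order. Hence [mu] is nonnegative and vanishes on assignments violating a
    derivation. *)
Lemma sum_derivations (S : {set V}) x : (4 * #|S| <= m)%N ->
  \sum_(f in derivations S) e (pairing (tot f) x - bval f) =
  if [forall f in derivations S, pairing (tot f) x - bval f == 0]
  then #|derivations S|%:R else 0.
Proof.
move=> le_m.
apply: (sum_expz w_prim (derivations_closed Du_closed Du_supp Du_ge3 expand le_m)).
by move=> f g _ _; exact: phaseD.
Qed.

Lemma mu_ge0 (S : {set V}) x : (4 * #|S| <= m)%N -> 0 <= mu S x.
Proof.
move=> le_m; rewrite /mu sum_derivations //; apply: mulr_ge0; first by rewrite invr_ge0 ler0n.
by case: ifP => _; rewrite ?ler0n.
Qed.

Lemma mu_eq0 (S : {set V}) x f : (4 * #|S| <= m)%N -> f \in derivations S ->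
  pairing (tot f) x != bval f -> mu S x = 0.
Proof.
move=> le_m fS ne; rewrite /mu sum_derivations //; case: forall_inP => [/(_ f fS)|_].
  by rewrite subr_eq0 (negPf ne).
by rewrite mulr0.
Qed.

Lemma mu_small (S : {set V}) x : (#|S| <= 1)%N -> mu S x = (#|G| ^ #|S|)%:R^-1.
Proof.
move=> S1; rewrite /mu (derivations_trivial Du_closed Du_supp Du_ge3 expand S1).
rewrite big_set1 /tot big1 => [|i _]; last exact: ffunE.
rewrite pairing0l /bval big1 => [|i _]; last by rewrite ffunE pairing0l.
by rewrite subr0 expz0 mulr1.
Qed.

Lemma eq_mu (S : {set V}) (x y : {ffun V -> G}) : {in S, x =1 y} -> mu S x = mu S y.
Proof.
move=> xy; congr (_ * _); apply: eq_bigr => f; rewrite inE => /andP[_ fS].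
by rewrite (@eq_pairing _ _ _ _ x y) // => v vf; apply/xy/(subsetP fS).
Qed.

(** Summing over the values on T \ S annihilates every derivation whose total is nonzero somewhere
    on T \ S; the survivors are exactly the derivations of [S]. *)
Lemma mu_marginal (S T : {set V}) x : S \subset T ->
  \sum_(b : asg G (T :\: S)) mu T (x + extend b) = mu S x.
Proof.
move=> sST; rewrite /mu -mulr_sumr exchange_big /=.
pose van (f : F) := [forall v in T :\: S, tot f v == 0].
have vanE f : (f \in derivations T) && van f = (f \in derivations S).
  rewrite !inE -andbA; congr (_ && _); apply/andP/idP => [[/suppP fT /forall_inP fv]|fS].
    apply/suppP => v vS; have [vT|/fT//] := boolP (v \in T).
    by apply/eqP/fv; rewrite inE vS.
  split; first exact: subset_trans sST.
  apply/forall_inP => v; rewrite inE => /andP[vS _].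
  by move/suppP: fS => ->.
rewrite (bigID van) /= [X in _ + X]big1 ?addr0 => [|f /andP[_ nv]]; last first.
  under eq_bigr do rewrite pairingDr addrAC expzD //.
  by rewrite -mulr_sumr (sum_asg w_prim) -/(van f) (negPf nv) mulr0.
rewrite (eq_bigl _ _ vanE) !mulr_sumr; apply: eq_bigr => f.
rewrite -vanE => /andP[_ vf].
under eq_bigr do rewrite pairingDr addrAC expzD //.
rewrite -mulr_sumr (sum_asg w_prim) -/(van f) vf mulrCA mulrC; congr (_ * _).
rewrite cardsD (setIidPr sST) mulrC.
apply: (mulfI (card_zmodX_neq0 _ G #|S|)); rewrite mulfV ?card_zmodX_neq0 //.
rewrite mulrA -natrM -expnD subnKC ?subset_leq_card // mulfV ?card_zmodX_neq0 //.
Qed.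

(** The prescribed inner product of E_c and E_d. For small support of c - d the picked derivation is
    the only one. *)
Definition gramK (c d : {ffun V -> D}) : C :=
  if [pick f | derivation f && (tot f == c - d)] is Some f then e (- bval f) else 0.

Lemma gramKE c d f : derivation f -> tot f = c - d ->
  (4 * #|supp (c - d)%R| <= m)%N ->
  gramK c d = e (- bval f).
Proof.
move=> fd Df le_m; rewrite /gramK; case: pickP => [g /andP[gd /eqP Dg]|].
  rewrite (tot_inj Du_closed Du_supp Du_ge3 expand fd gd) ?Df //.
by move/(_ f); rewrite fd Df eqxx.
Qed.

Lemma gramK_neq0 c d : gramK c d != 0 -> exists2 f, derivation f & tot f = c - d.
Proof.
rewrite /gramK; case: pickP => [f /andP[fd /eqP Df] _|_]; last by rewrite eqxx.
by exists f.
Qed.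

(** With supports at most m/16, a derivation of c - d has at most m/4 active constraints, so sums
    and differences of two are still derivations. The zero derivation, negation and addition then
    supply the three hypotheses of [block_gram]. *)
Lemma gram_vectors : exists E : {ffun V -> D} -> {ffun V -> D} -> C,
  forall c d, (16 * #|supp c| <= m)%N -> (16 * #|supp d| <= m)%N ->
    \sum_r E c r * (E d r)^* = gramK c d.
Proof.
have suppB (c d : {ffun V -> D}) : (#|supp (c - d)%R| <= #|supp c| + #|supp d|)%N.
  rewrite -(suppN d); apply: leq_trans (subset_leq_card (suppD _ _)) _.
  exact: leq_card_setU.
have dN f : derivation f -> derivation (- f) by exact: derivationN.
have le4 (c d : {ffun V -> D}) : (16 * #|supp c| <= m)%N ->
    (16 * #|supp d| <= m)%N -> (4 * #|supp (c - d)%R| <= m)%N.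
  by move=> hc hd; apply: leq_trans (leq_mul (leqnn 4) (suppB c d)) _; lia.
have dle (c d : {ffun V -> D}) f : (16 * #|supp c| <= m)%N ->
    (16 * #|supp d| <= m)%N -> derivation f -> tot f = c - d ->
    (2 * #|active f| <= m)%N.
  move=> hc hd fd Df; have := active_le Du_supp Du_ge3 expand fd.
  by rewrite Df; have := le4 _ _ hc hd; lia.
apply: (@block_gram _ _ gramK (fun c => (16 * #|supp c| <= m)%N)).
- move=> c hc; rewrite (@gramKE _ _ 0) ?subrr ?supp0 ?cards0 //.
  + rewrite /bval big1 ?oppr0 ?expz0 // => i _.
    by rewrite ffunE pairing0l.
  + exact: derivation0.
  by rewrite /tot big1 // => i _; exact: ffunE.
- move=> c d hc hd; have [Kcd|/gramK_neq0[f fd Df]] := eqVneq (gramK c d) 0.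
    rewrite Kcd conjC0; apply/eqP; apply: contraT => /gramK_neq0[f fd Df].
    have := @gramKE c d (- f) (dN _ fd); rewrite totN Df opprB Kcd => h.
    have /eqP := h erefl (le4 _ _ hc hd).
    by rewrite eq_sym (negPf (expz_neq0 w_prim _)).
  rewrite (gramKE fd Df) ?le4 // (@gramKE d c (- f)) ?dN ?totN ?Df ?opprB ?le4 //.
  by rewrite (expz_conj w_prim) bvalN.
move=> c d b hc hd hb /gramK_neq0[f fd Df].
have hf := dle _ _ _ hc hd fd Df.
(* If d - b is not derivable, neither is c - b: a derivation of c - b minus that of c - d would
   derive d - b. *)
have [Kdb|/gramK_neq0[g gd Dg]] := eqVneq (gramK d b) 0.
  rewrite Kdb mulr0; apply/eqP; apply: contraT => /gramK_neq0[g gd Dg].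
  have hg := dle _ _ _ hc hb gd Dg.
  have gfd : derivation (g - f) by apply: derivationB => //; lia.
  have := @gramKE d b (g - f) gfd.
  rewrite totD totN Df Dg addrC opprB addrA subrK Kdb => h.
  have /eqP := h erefl (le4 _ _ hd hb).
  by rewrite eq_sym (negPf (expz_neq0 w_prim _)).
have hg := dle _ _ _ hd hb gd Dg.
have gfd : derivation (f + g).
  rewrite -[g]opprK; apply: derivationB => //; first exact: dN.
  by rewrite activeN; lia.
rewrite (gramKE fd Df) ?(gramKE gd Dg) ?(@gramKE c b (f + g)) ?le4 //.
  by rewrite -(expzD w_prim) bvalD opprD.
by rewrite totD Df Dg addrA subrK.
Qed.

Hypothesis cardG : (#|G| %| n.+2)%N.

Definition splice (S : {set V}) (x y : {ffun V -> G}) : {ffun V -> G} :=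
  [ffun v => if v \in S then x v else y v].

(* The pairs [(c, c - t)] are a translate of the characters supported in
   [S :&: T], over which [e] sums to zero unless [x] and [y] agree there. *)
Lemma sum_shifted (S T : {set V}) (t : {ffun V -> D}) x y :
    supp t \subset S :|: T ->
  \sum_(c | (supp c \subset S) && (supp (c - t) \subset T))
     e (pairing c x - pairing (c - t) y) =
  if [forall v in S :&: T, x v == y v]
  then (#|G| ^ #|S :&: T|)%:R * e (pairing t (splice S x y)) else 0.
Proof.
(* [tS] is the translation vector: it lives on [S], and [tS - t] lives on T \ S. *)
move=> /suppP tST; pose tS : {ffun V -> D} := [ffun v => if v \in S then t v else 0].
rewrite (reindex_inj (addrI tS)) /=.
have supE c : (supp (tS + c) \subset S) && (supp (tS + c - t) \subset T) =
              (supp c \subset S :&: T).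
  apply/andP/suppP => [[/suppP cS /suppP cT] v|cST].
    rewrite inE negb_and; have [vS /= vT|vS _] := boolP (v \in S).
      by have := cT v vT; rewrite !ffunE vS addrAC subrr add0r.
    by have := cS v vS; rewrite !ffunE (negPf vS) add0r.
  split; apply/suppP => v vN; rewrite !ffunE cST ?inE ?(negPf vN) ?andbF // addr0 //.
  have [vS|vS] := boolP (v \in S); first by rewrite subrr.
  by rewrite tST ?subrr // inE negb_or vS.
rewrite (eq_bigl _ _ supE).
have phE c : pairing (tS + c) x - pairing (tS + c - t) y =
             pairing t (splice S x y) + pairing c (x - y).
  rewrite addrAC (pairingDl tS c) (pairingDl (tS - t) c) pairingDr pairingNr.
  rewrite opprD addrACA; congr (_ + _).
  rewrite -pairingNl /pairing -big_split; apply: eq_bigr => v _ /=.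
  have -> : (- (tS - t)) v = t v - tS v by rewrite opprB ffunE [(- tS) v]ffunE.
  rewrite [tS v]ffunE [splice _ _ _ v]ffunE.
  case: ifP => vS; first by rewrite subrr dual0l addr0.
  by rewrite dual0l add0r subr0.
under eq_bigr do rewrite phE (expzD w_prim).
rewrite -mulr_sumr (sum_supp_sub w_prim cardG).
have -> : [forall v in S :&: T, (x - y) v == 0] = [forall v in S :&: T, x v == y v].
  by apply: eq_forallb => v; rewrite !ffunE subr_eq0.
by case: ifP => _; rewrite ?mulr0 // mulrC.
Qed.

Definition fourier_vec (E : {ffun V -> D} -> {ffun V -> D} -> C)
    (S : {set V}) x r : C :=
  (#|G| ^ #|S|)%:R^-1 * \sum_(c | supp c \subset S) e (pairing c x) * E c r.

(** Expand both vectors, rewrite the Gram entries as sums over derivations, and exchange sums. For a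
    fixed derivation f the pairs (c, c - tot f) are summed by [sum_shifted], leaving the Fourier
    series of [mu] on the union. *)
Lemma fourier_vec_gram E (S T : {set V}) x y :
    (forall c d, (16 * #|supp c| <= m)%N -> (16 * #|supp d| <= m)%N ->
       \sum_r E c r * (E d r)^* = gramK c d) ->
    (16 * #|S| <= m)%N -> (16 * #|T| <= m)%N ->
  \sum_r fourier_vec E S x r * (fourier_vec E T y r)^* =
  if [forall v in S :&: T, x v == y v] then mu (S :|: T) (splice S x y) else 0.
Proof.
move=> EK leS leT; set nS : C := (#|G| ^ #|S|)%:R^-1; set nT : C := (#|G| ^ #|T|)%:R^-1.
have leST : (4 * #|S :|: T| <= m)%N.
  by have [h _] := leq_card_setU S T; lia.
transitivity (nS * nT * \sum_(c | supp c \subset S) \sum_(d | supp d \subset T)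
                e (pairing c x - pairing d y) * gramK c d).
  have rE r : fourier_vec E S x r * (fourier_vec E T y r)^* =
      nS * nT * \sum_(c | supp c \subset S) \sum_(d | supp d \subset T)
        (e (pairing c x) * E c r) * (e (pairing d y) * E d r)^*.
    rewrite /fourier_vec rmorphM rmorph_sum /= fmorphV rmorph_nat -/nS -/nT.
    rewrite mulrACA mulr_suml; congr (_ * _); apply: eq_bigr => c _.
    exact: mulr_sumr.
  under eq_bigr do rewrite rE.
  rewrite -mulr_sumr exchange_big /=; congr (_ * _); apply: eq_bigr => c cS.
  rewrite exchange_big /=; apply: eq_bigr => d dT.
  rewrite -EK; last 2 first.
  - by apply: leq_trans leS; rewrite leq_mul2l subset_leq_card.
  - by apply: leq_trans leT; rewrite leq_mul2l subset_leq_card.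
  rewrite mulr_sumr; apply: eq_bigr => r _.
  by rewrite rmorphM /= (expz_conj w_prim) mulrACA (expzD w_prim).
(* By [tot_inj] this sum has at most one term; the form as a sum is what permits exchanging the
   order of summation. *)
have KE (c d : {ffun V -> D}) : supp c \subset S -> supp d \subset T ->
    gramK c d = \sum_(f in derivations (S :|: T) | d == c - tot f) e (- bval f).
  move=> cS dT; have sub : supp (c - d) \subset S :|: T.
    by apply: subset_trans (suppD _ _) _; rewrite suppN setUSS.
  have le4 : (4 * #|supp (c - d)%R| <= m)%N.
    by apply: leq_trans leST; rewrite leq_mul2l subset_leq_card.
  have [K0|/gramK_neq0[f fd Df]] := eqVneq (gramK c d) 0.
    rewrite K0 big1 // => f /andP[]; rewrite inE => /andP[fd _] /eqP Dd.
    have Df : tot f = c - d by rewrite Dd opprB addrC subrK.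
    by move: K0; rewrite (gramKE fd Df le4).
  rewrite (gramKE fd Df le4) (big_pred1 f) // => g.
  rewrite !inE; apply/andP/eqP => [[/andP[gd _] /eqP Dd]|->].
    apply: (tot_inj Du_closed Du_supp Du_ge3 expand gd fd).
      by rewrite Df Dd opprB addrC subrK.
    by rewrite (_ : tot g = c - d) // Dd opprB addrC subrK.
  by rewrite fd Df sub opprB addrC subrK.
transitivity (nS * nT * \sum_(f in derivations (S :|: T)) e (- bval f) *
    \sum_(c | (supp c \subset S) && (supp (c - tot f) \subset T))
       e (pairing c x - pairing (c - tot f) y)).
  congr (_ * _).
  under eq_bigr => c cS.
    under eq_bigr => d dT do rewrite KE // mulr_sumr.
    rewrite (exchange_big_dep (fun f => f \in derivations (S :|: T))) /=; last first.
      by move=> d f _ /andP[].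
    over.
  rewrite exchange_big /=; apply: eq_bigr => f fST.
  rewrite mulr_sumr [RHS]big_mkcondr; apply: eq_bigr => c cS.
  rewrite (eq_bigl (fun d => (d == c - tot f) && (supp (c - tot f) \subset T))).
    by rewrite big_mkcondr big_pred1_eq mulrC.
  by move=> d; rewrite fST /= andbC; case: eqP => // ->.
under eq_bigr => f.
  rewrite inE => /andP[_ fST]; rewrite sum_shifted //; over.
case: ifP => _; last by rewrite big1 ?mulr0 // => f _; rewrite mulr0.
under eq_bigr do rewrite mulrCA -(expzD w_prim) addrC.
rewrite -mulr_sumr mulrA; congr (_ * _).
(* The normalizations match because |S| + |T| equals the size of the union plus that of the
   intersection. *)
have hU : (#|G| ^ #|S :|: T| * #|G| ^ #|S :&: T| = #|G| ^ #|S| * #|G| ^ #|T|)%N.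
  by rewrite -!expnD cardsUI.
apply: (mulfI (card_zmodX_neq0 _ G #|S :|: T|)); rewrite mulfV ?card_zmodX_neq0 //.
rewrite mulrCA -natrM hU natrM /nS /nT -invfM mulVf // mulf_neq0 ?card_zmodX_neq0 //.
Qed.

End FourierSolution.

(** * Annihilators of the constraint subgroups *)

Section Annihilator.

Variables (n : nat) (G : finZmodType) (V : finType) (k : nat) (v : 'I_k -> V).
Local Notation D := (dual n G).
Hypothesis v_inj : injective v.
Variable H : {set {ffun 'I_k -> G}}.

Definition annihilator : {set {ffun V -> D}} :=
  [set c | (supp c \subset [set v j | j in 'I_k]) &&
           [forall h in H, \sum_j c (v j) (h j) == 0]].

Lemma annihilator_supp c : c \in annihilator -> supp c \subset [set v j | j in 'I_k].
Proof. by rewrite inE => /andP[]. Qed.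

Lemma annihilator_eq0 c h : c \in annihilator -> h \in H ->
  \sum_j c (v j) (h j) = 0.
Proof. by rewrite inE => /andP[_ /forall_inP hc] /hc/eqP. Qed.

Lemma pairing_reindex (c : {ffun V -> D}) x : supp c \subset [set v j | j in 'I_k] ->
  pairing c x = \sum_j c (v j) (x (v j)).
Proof.
move=> /suppP cv; rewrite /pairing (bigID (fun u => u \in [set v j | j in 'I_k])) /=.
rewrite [X in _ + X]big1 ?addr0 => [|u /cv ->]; last exact: dual0l.
by rewrite big_imset //= => i j _ _; exact: v_inj.
Qed.

Lemma annihilator_closed : GRing.zmod_closed [in annihilator].
Proof.
split=> [|c d cA dA].
  rewrite inE supp0 sub0set /=; apply/forall_inP => h _; apply/eqP.
  by rewrite big1 // => j _; rewrite ffunE dual0l.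
rewrite inE; apply/andP; split.
  apply: subset_trans (suppD _ _) _.
  by rewrite suppN subUset !annihilator_supp.
apply/forall_inP => h hH.
have -> : \sum_j (c - d) (v j) (h j) =
          \sum_j c (v j) (h j) - \sum_j d (v j) (h j).
  rewrite -sumrB; apply: eq_bigr => j _.
  by rewrite ffunE dualDl; congr (_ + _); rewrite !ffunE.
by rewrite !annihilator_eq0 // subrr.
Qed.

Lemma balanced_surj (i j : 'I_k) (g g' : G) :
    balanced_pairwise_independent H -> i != j ->
  exists2 h, h \in H & h i = g /\ h j = g'.
Proof.
move=> [_ Hp] ij; have := Hp i j g g' ij; rewrite /unif_pr.
have [->|[h]] := set_0Vmem [set x in H | (x i == g) && (x j == g')].
  rewrite cards0 mul0r => /esym/eqP; rewrite mul1r invr_eq0 expf_eq0 /= pnatr_eq0.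
  by rewrite eqn0Ngt card_zmod_gt0.
by rewrite inE => /andP[hH /andP[/eqP hi /eqP hj]] _; exists h.
Qed.

(* Pairwise independence lets a nontrivial value of [c] at one coordinate be
   realized in [H] with [0] at any second one. *)
Lemma annihilator_ge3 c : (3 <= k)%N -> balanced_pairwise_independent H ->
  c \in annihilator -> c != 0 -> (3 <= #|supp c|)%N.
Proof.
move=> k3 Hb cA c0; rewrite leqNgt; apply/negP => c3.
have [j0 cj0] : exists j0, c (v j0) != 0.
  apply/existsP; apply: contraNT c0 => /existsPn h; apply/eqP/ffunP => u.
  rewrite ffunE; have /suppP cs := annihilator_supp cA.
  have [/imsetP[j _ ->]|/cs//] := boolP (u \in [set v j | j in 'I_k]).
  by have := h j; rewrite negbK => /eqP.
(* [c] is to vanish off [j0] and [j1]: take for [j1] the second coordinate of the support if there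
   is one, and otherwise any other index, which exists since k >= 3. *)
have [j1 j01 cj1] : exists2 j1 : 'I_k, j1 != j0 &
    forall j, j != j0 -> j != j1 -> c (v j) = 0.
  have [/existsP[j1 /andP[j10 cj1]]|/existsPn h] :=
    boolP [exists j1, (j1 != j0) && (c (v j1) != 0)].
    exists j1 => // j jj0 jj1; apply: contraTeq c3 => cj; rewrite -leqNgt.
    have : [set v j; v j0; v j1] \subset supp c.
      by apply/subsetP => u; rewrite !inE => /orP[/orP[]|] /eqP->.
    move/subset_leq_card; apply: leq_trans.
    rewrite -setUA cardsU1 !inE negb_or !(inj_eq v_inj) jj0 jj1 cards2.
    by rewrite (inj_eq v_inj) eq_sym j10.
  have : (1 < #|'I_k|)%N by rewrite card_ord; lia.
  rewrite (cardD1 j0) inE add1n ltnS => /card_gt0P[j1]; rewrite inE => /andP[j10 _].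
  exists j1 => // j jj0 _; have := h j.
  by rewrite jj0 negbK => /eqP.
case/negP: cj0; apply/dual_eq0P => g.
have j01' : j0 != j1 by rewrite eq_sym.
have [h hH [h0 h1]] := balanced_surj g 0 Hb j01'.
have := annihilator_eq0 cA hH.
rewrite (bigD1 j0) //= (bigD1 j1) //= big1 => [|j /andP[jj0 jj1]].
  by rewrite h0 h1 dual0r !addr0.
by rewrite cj1 // dual0l.
Qed.

(** A character of G^k trivial on [H] but not at [b] splits into its coordinate characters, which
    are transported to [V] along the injection [v]. *)
Lemma annihilator_separates (b : {ffun 'I_k -> G}) :
    (#|G| %| n.+2)%N -> GRing.zmod_closed [in H] -> b \notin H ->
  exists2 c, c \in annihilator & \sum_j c (v j) (b j) != 0.
Proof.
move=> cardG clH bH.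
have tors (x : {ffun 'I_k -> G}) : x *+ n.+2 = 0.
  by apply/ffunP => j; rewrite ffunMnE dual_torsion // ffunE.
have [f [fD f0 fb]] := separating_character tors clH bH.
have fz : f 0 = 0 by apply: f0; case: clH.
have fj j : exists d : D, forall g, d g = f (single j g).
  apply: dual_of_morph => g g'; rewrite -fD; congr f.
  by apply/ffunP => i; rewrite !ffunE; case: eqP; rewrite ?addr0.
have [d dE] := fin_all_exists fj.
have fE x : f x = \sum_j d j (x j).
  have {1}-> : x = \sum_j single j (x j).
    apply/ffunP => i; rewrite sum_ffunE (bigD1 i) //= big1 ?addr0 ?ffunE ?eqxx //.
    by move=> j ji; rewrite ffunE eq_sym (negPf ji).
  by rewrite (big_morph f fD fz); apply: eq_bigr => j _; rewrite dE.
pose c : {ffun V -> D} := [ffun u => if [pick j | v j == u] is Some j then d j else 0].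
have cE j : c (v j) = d j.
  rewrite ffunE; case: pickP => [i /eqP/v_inj->//|/(_ j)].
  by rewrite eqxx.
have sE (x : {ffun 'I_k -> G}) : \sum_j c (v j) (x j) = f x.
  by rewrite fE; apply: eq_bigr => j _; rewrite cE.
exists c; last by rewrite sE.
rewrite inE; apply/andP; split; last first.
  by apply/forall_inP => h hH; rewrite sE f0.
apply/suppP => u; rewrite ffunE; case: pickP => // j /eqP <-.
by rewrite imset_f.
Qed.

End Annihilator.

(** * From complex to real vectors *)

Section Realification.

Variables (R : realType) (T : finType).

Definition realify (f : T -> R[i]) : 'rV[R]_(#|T| + #|T|) :=
  row_mx (\row_j complex.Re (f (enum_val j))) (\row_j complex.Im (f (enum_val j))).

Lemma dotv_realify (f g : T -> R[i]) :
  dotv (realify f) (realify g) = complex.Re (\sum_t f t * (g t)^*).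
Proof.
rewrite /dotv /realify tr_row_mx mul_row_col mxE !mxE -big_split /=.
rewrite raddf_sum /= [RHS](reindex_onto enum_val enum_rank) /=; last first.
  by move=> t _; rewrite enum_rankK.
rewrite [RHS](eq_bigl predT) => [|j]; last by rewrite enum_valK eqxx.
apply: eq_bigr => j _; rewrite !mxE.
by case: (f _) => a b; case: (g _) => a' b' /=; rewrite mulrN opprK.
Qed.

End Realification.

(** * The Lasserre solution *)

Section LasserreSolution.

Variables (R : realType) (n : nat) (G : finZmodType) (V J : finType).
Local Notation D := (dual n G).
Variable w : R[i].
Hypothesis w_prim : n.+2.-primitive_root w.
Hypothesis cardG : (#|G| %| n.+2)%N.
Variables (sc : J -> {set V}) (Du : J -> {set {ffun V -> D}}) (m : nat).
Hypothesis Du_closed : forall i, GRing.zmod_closed [in Du i].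
Hypothesis Du_supp : forall i c, c \in Du i -> supp c \subset sc i.
Hypothesis Du_ge3 : forall i c, c \in Du i -> c != 0 -> (3 <= #|supp c|)%N.
Hypothesis expand : forall A : {set J}, (#|A| <= m)%N ->
  (4 * \sum_(i in A) #|sc i| <= 4 * #|\bigcup_(i in A) sc i| + 5 * #|A|)%N.
Hypothesis m16 : (16 <= m)%N.
Variable pt : J -> {ffun V -> G}.
Variable t : R.
Hypothesis le_t : forall N : nat, N%:R <= 16 * t -> (N <= m)%N.

Local Notation mu := (mu w Du m pt).

Lemma agreeE (S T : {set V}) (a : asg G S) (b : asg G T) :
  agree a b = [forall v in S :&: T, extend a v == extend b v].
Proof.
apply/forallP/forall_inP => [h v|h x].
  rewrite inE => /andP[vS vT]; have /forallP/(_ (exist _ v vT)) := h (exist _ v vS).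
  by rewrite /= eqxx -!extendE.
apply/forallP => y; apply/implyP => /eqP xy; rewrite -!extendE -xy; apply: h.
by rewrite inE (valP x) xy (valP y).
Qed.

Lemma extend_glue (W S T : {set V}) (a : asg G S) (b : asg G T) v : v \in W ->
  extend (glue W a b) v = if v \in S then extend a v else extend b v.
Proof.
move=> vW; rewrite (extendE _ (exist _ v vW)) [LHS]ffunE /=.
case: insubP => [y -> Dy|/negPf vS]; first by rewrite -Dy extendE.
by rewrite vS [RHS]ffunE.
Qed.

Lemma mu_Re_ge0 (S : {set V}) x : (4 * #|S| <= m)%N -> 0 <= complex.Re (mu S x).
Proof.
move=> le_m; have := mu_ge0 w_prim Du_closed Du_supp Du_ge3 expand pt x le_m.
by case: (mu S x) => a b; rewrite lecE /= => /andP[].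
Qed.

(** The cutoff covers the sets of size up to 2t. Beyond it the value 0 satisfies constraints with
    large scopes at once. *)
Definition loc (S : {set V}) (a : asg G S) : R :=
  if (8 * #|S| <= m)%N then complex.Re (mu S (extend a)) else 0.

Lemma mu_set0 x : mu set0 x = 1.
Proof.
rewrite (mu_small w Du_closed Du_supp Du_ge3 expand) ?cards0 //.
by rewrite expn0 invr1.
Qed.

Lemma loc_marginal (S T : {set V}) (a : asg G S) : S \subset T ->
  (8 * #|T| <= m)%N -> \sum_(b : asg G (T :\: S)) loc (glue T a b) = loc a.
Proof.
move=> sST leT; have leS : (8 * #|S| <= m)%N.
  by apply: leq_trans leT; rewrite leq_mul2l subset_leq_card.
rewrite /loc leT leS -(mu_marginal w_prim Du m pt (extend a) sST) raddf_sum.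
apply: eq_bigr => b _; congr (complex.Re _); apply: eq_mu => v vT.
rewrite extend_glue // [RHS]ffunE; case: ifP => vS.
  by rewrite (extend_out b) ?addr0 // inE vS.
by rewrite (extend_out a) ?add0r ?vS.
Qed.

Lemma loc_le1 (S : {set V}) (a : asg G S) : (8 * #|S| <= m)%N -> loc a <= 1.
Proof.
(* The mass of [a] is one of the nonnegative terms that sum to the mass 1 of the empty
   assignment. *)
move=> leS; pose a0 : asg G (set0 : {set V}) := 0.
have loc0 : loc a0 = 1 by rewrite /loc cards0 muln0 leq0n mu_set0.
rewrite -loc0 -(loc_marginal a0 (sub0set S) leS).
pose b : asg G (S :\: set0) := [ffun x => extend a (val x)].
have -> : a = glue S a0 b.
  apply/ffunP => x; rewrite -!extendE extend_glue ?(valP x) // inE.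
  have xS : val x \in S :\: set0 by rewrite setD0 (valP x).
  by have := extendE b (exist _ (val x) xS); rewrite [b _]ffunE /= => ->.
rewrite (bigD1 b) //= lerDl; apply: sumr_ge0 => b' _.
by rewrite /loc leS; apply: mu_Re_ge0; lia.
Qed.

Lemma local_distribution_loc : local_distribution (2 * t) loc.
Proof.
have le8 (S : {set V}) : #|S|%:R <= 2 * t -> (8 * #|S| <= m)%N.
  by move=> h; apply: le_t; rewrite natrM; lra.
split=> [S a /le8 leS|a|S T a sST /le8 leT].
- rewrite loc_le1 // andbT /loc leS; apply: mu_Re_ge0; lia.
- by rewrite /loc cards0 muln0 leq0n mu_set0.
exact: loc_marginal.
Qed.

(** The last clause serves the constraints: a violated derivation has to be exhibited only for sets
    within the cutoff of [loc]. *)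
Lemma lasserre_of_derivations : exists (d : nat)
    (U : forall S : {set V}, asg G S -> 'rV[R]_d)
    (X : forall S : {set V}, asg G S -> R),
  [/\ lasserre_solution t U X, balanced_solution U X &
      forall (S : {set V}) (a : asg G S),
        ((8 * #|S| <= m)%N -> exists2 f, f \in derivations Du m S &
           pairing (tot f) (extend a) != bval pt f) ->
        X S a = 0].
Proof.
have [E EK] := gram_vectors w_prim Du_closed Du_supp Du_ge3 expand pt.
pose U (S : {set V}) (a : asg G S) := realify (fourier_vec w E S (extend a)).
exists _, U, loc.
have gram (S T : {set V}) (a : asg G S) (b : asg G T) :
    (16 * #|S| <= m)%N -> (16 * #|T| <= m)%N ->
    dotv (U S a) (U T b) = if agree a b then loc (glue (S :|: T) a b) else 0.
  move=> leS leT; rewrite dotv_realify.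
  rewrite (fourier_vec_gram w_prim Du_closed Du_supp Du_ge3 expand cardG _ _ EK) //.
  rewrite -agreeE; case: ifP => // _.
  have leST : (8 * #|S :|: T| <= m)%N by have [h _] := leq_card_setU S T; lia.
  rewrite /loc leST; congr (complex.Re _); apply: eq_mu => v vST.
  by rewrite extend_glue // ffunE.
have le16 (S : {set V}) : #|S|%:R <= t -> (16 * #|S| <= m)%N.
  by move=> h; apply: le_t; rewrite natrM; lra.
split.
- split; first exact: local_distribution_loc.
  by move=> S T a b /le16 leS /le16 leT; apply: gram.
- move=> v g; set a := asg1 v g.
  have l1 : loc a = 1 / #|G|%:R.
    rewrite /loc cards1 muln1 ifT; last by lia.
    rewrite (mu_small w Du_closed Du_supp Du_ge3 expand) ?cards1 //.
    rewrite expn1 mul1r.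
    by rewrite -[#|G|%:R in LHS](rmorph_nat (real_complex R)) -fmorphV.
  split=> //; rewrite gram ?cards1 ?muln1 //.
  have -> : agree a a.
    by rewrite agreeE; apply/forall_inP.
  rewrite /loc setUid; case: ifP => // _; congr (complex.Re _).
  by apply: eq_mu => u uv; rewrite extend_glue //; case: ifP.
move=> S a h; rewrite /loc; case: ifP => // leS; have [f fS ne] := h leS.
rewrite (mu_eq0 w_prim Du_closed Du_supp Du_ge3 expand _ fS ne) //; lia.
Qed.

End LasserreSolution.

(* Fewer than one round: only the empty set is constrained, and the one-vertex
   marginals are constrained by balance alone. *)
Lemma lasserre_lt1 (R : realType) (G : finZmodType) (V : finType) (t : R) :
    t < 1 ->
  exists (d : nat) (U : forall S : {set V}, asg G S -> 'rV[R]_d)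
         (X : forall S : {set V}, asg G S -> R),
    [/\ lasserre_solution t U X, balanced_solution U X &
        forall (S : {set V}) (a : asg G S), (2 <= #|S|)%N -> X S a = 0].
Proof.
move=> t1; have G0 := card_zmod_gt0 G.
pose x (k : nat) : R := if (k <= 1)%N then (#|G| ^ k)%:R^-1 else 0.
have x0 : x 0%N = 1 by rewrite /x expn0 invr1.
have x_ge0 k : 0 <= x k by rewrite /x; case: ifP; rewrite ?invr_ge0 ?ler0n.
(* One dimension suffices: for t < 1 the Gram condition concerns at most the empty set, and the
   square root gives singletons the squared norm 1/|G|. *)
exists 1%N, (fun (S : {set V}) _ => (Num.sqrt (x #|S|))%:M),
  (fun (S : {set V}) _ => x #|S|).
have dotE k : dotv ((Num.sqrt (x k))%:M : 'rV_1) (Num.sqrt (x k))%:M = x k.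
  by rewrite /dotv tr_scalar_mx -scalar_mxM mxE mulr1n -expr2 sqr_sqrtr.
split.
- split; [split|].
  + move=> S _ _; rewrite x_ge0 /= /x; case: ifP => // _.
    by rewrite invf_le1 ?ltr0n ?ler1n ?expn_gt0 ?G0.
  + by move=> _; rewrite cards0 x0.
  + move=> S T _ sST le_T; rewrite sumr_const.
    have T1 : (#|T| <= 1)%N.
      by rewrite -ltnS -(ltr_nat R); lra.
    have S1 : (#|S| <= 1)%N by apply: leq_trans T1; exact: subset_leq_card.
    have -> : #|asg G (T :\: S)| = (#|G| ^ (#|T| - #|S|))%N.
      transitivity (#|G| ^ #|T :\: S|)%N; first by rewrite card_ffun card_sig.
      by rewrite cardsD (setIidPr sST).
    rewrite /x T1 S1.
    rewrite -[LHS]mulr_natl; apply: (mulfI (card_zmodX_neq0 _ G #|S|)).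
    rewrite mulrA -natrM -expnD subnKC ?subset_leq_card //.
    by rewrite !mulfV ?card_zmodX_neq0.
  move=> S T a b leS leT.
  have S0 : #|S| = 0%N.
    by apply/eqP; rewrite -leqn0 -ltnS -(ltr_nat R); lra.
  have T0 : #|T| = 0%N.
    by apply/eqP; rewrite -leqn0 -ltnS -(ltr_nat R); lra.
  rewrite S0 T0 dotE; have /cards0_eq DS := S0; have /cards0_eq DT := T0.
  rewrite ifT ?DS ?DT ?setUid ?cards0 //.
  apply/forallP => -[v vS]; exfalso; move: vS; rewrite -[S]/(S : {set V}).
  by rewrite DS inE.
- by move=> v g; rewrite cards1 dotE /x expn1 mul1r.
by move=> S _ S2; rewrite /x leqNgt S2.
Qed.

(** * Assembly for an expanding instance *)

Theorem theorem5 (R : realType) (G : finZmodType) (l : nat) (k : 'I_l -> nat)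
    (P : forall i : 'I_l, {set {ffun 'I_(k i) -> G}})
    (k_ge3 : forall i : 'I_l, (3 <= k i)%N)
    (P_coset : forall i : 'I_l, bpi_coset (P i))
    (V : finType) (I : csp_instance k V) (s delta : R)
    (delta_le : delta <= 1 / 4)
    (I_expanding : expanding I s (1 + delta)) :
  exists (d : nat) (U : forall S : {set V}, asg G S -> 'rV[R]_d)
         (X : forall S : {set V}, asg G S -> R),
    [/\ lasserre_solution (s / 16) U X,
        balanced_solution U X &
        forall i : 'I_(csp_size I), satisfies_constraint P X i].
Proof.
have scope_card i : #|scope (I := I) i| = k (ctype I i).
  by rewrite card_imset ?card_ord //; exact: cvar_inj.
(* Below one round the degenerate solution works, since it vanishes on all scopes, which have at
   least 3 variables. *)
have [s16|s16] := ltP s 16.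
  have [|d [U [X [sol bal X0]]]] := @lasserre_lt1 R G V (s / 16); first by lra.
  exists d, U, X; split=> // i a _; apply: X0.
  by rewrite scope_card; apply: ltnW; exact: k_ge3.
have [H HP] := fin_all_exists P_coset.
have [a PE] : exists a : forall i, {ffun 'I_(k i) -> G},
    forall i, P i = [set a i + h | h in H i].
  have ex i : exists x : {ffun 'I_(k i) -> G}, P i = [set x + h | h in H i].
    by have [_ _ []] := HP i => x; exists x.
  exact: fin_all_exists ex.
have clH i : GRing.zmod_closed [in H i] by have [] := HP i.
have Hbal i : balanced_pairwise_independent (H i) by have [] := HP i.
(* Doubling |G| gives a modulus of the form n + 2 divisible by |G| even for the trivial group. *)
pose n := (2 * #|G|).-2.
have Dn : n.+2 = (2 * #|G|)%N by have := card_zmod_gt0 G; rewrite /n; lia.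
have cardG : (#|G| %| n.+2)%N by rewrite Dn dvdn_mull.
have [w w_prim] := @prim_root_exists R[i] n.+2 isT.
pose m := Num.truncn s.
have le_m (N : nat) : (N <= m)%N = (N%:R <= s).
  by rewrite /m truncn_ge_nat //; lra.
pose Du i := annihilator n (cvar I i) (H (ctype I i)).
pose pt i : {ffun V -> G} := [ffun v =>
  if [pick j | cvar I i j == v] is Some j then a (ctype I i) j else 0].
have ptE i j : pt i (cvar I i j) = a (ctype I i) j.
  rewrite ffunE; case: pickP => [j' /eqP/cvar_inj->//|/(_ j)].
  by rewrite eqxx.
have Du_closed i : GRing.zmod_closed [in Du i] by exact: annihilator_closed.
have Du_supp i c : c \in Du i -> supp c \subset scope i.
  exact: annihilator_supp.
have Du_ge3 i c : c \in Du i -> c != 0 -> (3 <= #|supp c|)%N.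
  by apply: annihilator_ge3 => //; exact: cvar_inj.
(* As delta <= 1/4, the slack (1 + delta)|A| is at most (5/4)|A|. *)
have expand (A : {set 'I_(csp_size I)}) : (#|A| <= m)%N ->
    (4 * \sum_(i in A) #|scope i| <= 4 * #|\bigcup_(i in A) scope i| + 5 * #|A|)%N.
  rewrite le_m => /I_expanding.
  move: (\sum_(i in A) _)%N #|\bigcup_(i in A) _| #|A| => x y z h.
  have z0 : 0 <= z%:R :> R by rewrite ler0n.
  rewrite -(ler_nat R) natrD !natrM; nra.
have [||d [U [X [sol bal X0]]]] := @lasserre_of_derivations R n G V _ w w_prim cardG
    _ Du m Du_closed Du_supp Du_ge3 expand _ pt (s / 16).
- by rewrite le_m.
- by move=> N hN; rewrite le_m; lra.
exists d, U, X; split=> // i x xP; apply: X0 => _.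
(* [b] is the deviation of [x] from the coset point; a violated constraint means it is not in the
   subgroup. A separating annihilator [c], used alone at constraint [i], is a derivation whose
   prescribed value [x] misses. *)
pose b := [ffun j => x (exist _ (cvar I i j) (cvar_scope j))] - a (ctype I i).
have bH : b \notin H (ctype I i).
  apply: contra xP => bH; rewrite PE; apply/imsetP; exists b => //.
  by rewrite /b addrC subrK.
have [c cA cb] := annihilator_separates (@cvar_inj _ _ _ I i) cardG (clH _) bH.
have pairE (y : {ffun V -> G}) :
    pairing c y = \sum_j c (cvar I i j) (y (cvar I i j)).
  exact: (pairing_reindex (@cvar_inj _ _ _ I i) y (annihilator_supp cA)).
have sgl j : j != i -> single i c j = 0 by move=> ji; rewrite ffunE (negPf ji).
have sglE : single i c i = c by rewrite ffunE eqxx.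
have totE : tot (single i c) = c.
  by rewrite /tot (bigD1 i) //= big1 ?addr0.
exists (single i c); rewrite ?totE.
  rewrite inE totE (subset_trans (annihilator_supp cA)) ?subxx // andbT.
  apply/andP; split.
    apply/forallP => j; rewrite ffunE; case: eqP => [->//|_].
    by case: (Du_closed j).
  apply: (@leq_trans 1); last by rewrite le_m; lra.
  rewrite -(cards1 i); apply: subset_leq_card; apply/subsetP => j.
  by rewrite !inE; apply: contraR => /sgl ->.
rewrite /bval (bigD1 i) //= sglE big1 => [|j /sgl->]; last exact: pairing0l.
rewrite addr0 -subr_eq0 -pairingNr -pairingDr pairE.
rewrite (eq_bigr (fun j => c (cvar I i j) (b j))) // => j _; congr (c _ _).
rewrite ffunE [(- pt i) _]ffunE ptE (extendE x (exist _ (cvar I i j) (cvar_scope j))).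
by rewrite [b j]ffunE !ffunE.
Qed.
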